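(* Let $n,k$ be positive integers with $n>\binom{k+1}{2}$ and let $\mathcal{F}\subseteq[n]^{(k)}$ be intersecting. Then there exists an $i\in[n]$ such that $\vert\partial(\mathcal{F}(i))\vert\geq\vert\mathcal{F}(i)\vert$.
   Context: $[n]=\{1,\dots,n\}$ and $X^{(k)}$ denotes the set of $k$-element subsets of $X$. A family $\mathcal{F}$ is intersecting if $F\cap F'\neq\emptyset$ for all $F,F'\in\mathcal{F}$. The shadow of a family $\mathcal{H}$ is $\partial\mathcal{H}=\{H\setminus\{x\}: x\in H\in\mathcal{H}\}$. For $i\in[n]$, the link is $\mathcal{F}(i)=\{F\setminus\{i\}: i\in F\in\mathcal{F}\}$. *)

(* Defs.v *)
From mathcomp Require Import all_boot.

Set Implicit Arguments.
Unset Strict Implicit.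
Unset Printing Implicit Defensive.

Section SetFamilies.

Variable T : finType.
Implicit Types (F H : {set {set T}}) (i : T).

Definition uniform (k : nat) F : Prop := forall A : {set T}, A \in F -> #|A| = k.

(* A and B may coincide, so an intersecting family does not contain set0. *)
Definition intersecting F : Prop :=
  forall A B : {set T}, A \in F -> B \in F -> A :&: B != set0.

Definition shadow H : {set {set T}} :=
  [set A :\ x | A in H, x in (A : {set T})].

Definition link F i : {set {set T}} :=
  [set A :\ i | A in F & i \in (A : {set T})].

End SetFamilies.

(* Main.v *)
(** Call a family deficient if it has more members than its shadow, and suppose
    every link of [F] is deficient.  Two cross-intersecting families cannot both
    be deficient: after compressing both, each contains a ballot set (removing
    the first maximum of the associated lattice path injects the non-ballot sets
    into the shadow), and two ballot sets can be compressed to disjoint ones.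
    Now build sets [U] of size at most [k + (k-1) + ... + (k-m+1)] such that for
    every [i] outside [U] some deficient subfamily of the link at [i] meets [U]
    in at least [m] points.  If for some [i] the trace cannot be raised, then
    for some [C] outside [U] the [m]-sets [S] of [U] with [S :|: C] in that
    subfamily form a deficient family; add [i] and [C] to [U].  A vertex outside
    the new [U] whose trace cannot be raised either would give a second such
    family, cross-intersecting with the first.  For [m = k] this is absurd,
    since links are [k-1]-uniform. *)

Require Import Defs.
From mathcomp Require Import all_boot perm zify.

Set Implicit Arguments.
Unset Strict Implicit.
Unset Printing Implicit Defensive.

(** * Shadows and deficiency *)

Definition cross_intersecting (T : finType) (P Q : {set {set T}}) :=
  forall A B : {set T}, A \in P -> B \in Q -> A :&: B != set0.

Definition deficient (T : finType) (F : {set {set T}}) : bool :=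
  #|shadow F| < #|F|.

Lemma shadowP (T : finType) (H : {set {set T}}) (B : {set T}) :
  reflect (exists A x, [/\ A \in H, x \in A & B = A :\ x]) (B \in shadow H).
Proof.
apply: (iffP imset2P) => [[A x AH xA ->]|[A [x [AH xA ->]]]].
  by exists A, x.
by exists A x.
Qed.

Lemma mem_shadow (T : finType) (H : {set {set T}}) (A : {set T}) (x : T) :
  A \in H -> x \in A -> A :\ x \in shadow H.
Proof. by move=> AH xA; apply/shadowP; exists A, x. Qed.

Lemma shadowS (T : finType) (G H : {set {set T}}) :
  G \subset H -> shadow G \subset shadow H.
Proof.
move=> /subsetP sGH; apply/subsetP=> B /shadowP[A [x [AG xA ->]]].
by apply: mem_shadow => //; apply: sGH.
Qed.

(** * Compressions of set families *)

Section Compression.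

Variables (T : finType) (i j : T).
Implicit Types (A B : {set T}) (Q : {set {set T}}).

Definition swap A : {set T} := tperm i j @: A.

Definition movable A := (j \in A) && (i \notin A).

(** The classical shift towards [i]; blocking moves onto members of [Q] keeps the map injective on
    [Q]. *)
Definition compress Q A := if movable A && (swap A \notin Q) then swap A else A.

Definition compression Q : {set {set T}} := compress Q @: Q.

Lemma mem_swap A x : (x \in swap A) = (tperm i j x \in A).
Proof.
by rewrite -[x in LHS](tpermK i j) mem_imset //; apply: perm_inj.
Qed.

Lemma swapK : involutive swap.
Proof. by move=> A; apply/setP=> x; rewrite !mem_swap tpermK. Qed.

Lemma movable_swap A : movable (swap A) = (i \in A) && (j \notin A).
Proof. by rewrite /movable !mem_swap tpermL tpermR. Qed.

Lemma swap_id A : (i \in A) = (j \in A) -> swap A = A.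
Proof.
move=> eij; apply/setP=> x; rewrite mem_swap.
by case: tpermP => [->|->|].
Qed.

Lemma swapD1 A x : swap (A :\ x) = swap A :\ tperm i j x.
Proof.
apply/setP=> y; rewrite !(mem_swap, inE); congr (~~ _ && _).
by rewrite -(inj_eq (@perm_inj _ (tperm i j))) tpermK.
Qed.

Lemma mem_compression Q B :
  (B \in compression Q) =
  (if movable B then (B \in Q) && (swap B \in Q)
   else (B \in Q) || (swap B \in Q)).
Proof.
apply/imsetP/idP => [[A AQ ->]|].
  rewrite /compress; have [/andP[mA sA]|] := boolP (movable A && _).
    have /negPf iA : i \notin A by case/andP: mA.
    by rewrite movable_swap iA swapK AQ orbT.
  by rewrite AQ; case: ifP => // _ /negbNE.
case: ifP => mB.
  by case/andP=> BQ sB; exists B => //; rewrite /compress mB sB.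
have [BQ _|BQ /= sB] := boolP (B \in Q).
  by exists B => //; rewrite /compress mB.
exists (swap B) => //; rewrite /compress swapK BQ andbT movable_swap.
case: ifP => // iB; apply/esym/swap_id; move: iB mB; rewrite /movable.
by case: (i \in B); case: (j \in B).
Qed.

Lemma card_compression Q : #|compression Q| = #|Q|.
Proof.
apply: card_in_imset => A B AQ BQ; rewrite /compress.
case: ifP => [/andP[_ sA]|_]; case: ifP => [/andP[_ sB]|_] //.
- exact: (can_inj swapK).
- by move=> E; rewrite E BQ in sA.
- by move=> E; rewrite -E AQ in sB.
Qed.

(** If [A :\ x] is movable, [A] and [swap A] both lie in [Q]: either [A] is movable and was blocked,
    or [A] contains both [i] and [j] and is fixed by [swap]. Otherwise one of the two suffices. *)
Lemma shadow_compression Q :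
  shadow (compression Q) \subset compression (shadow Q).
Proof.
apply/subsetP=> B /shadowP[A [x [AQ xA ->]]].
have sxA : tperm i j x \in swap A by rewrite mem_swap tpermK.
rewrite mem_compression swapD1; case: ifP => mB; last first.
  have : (A \in Q) || (swap A \in Q).
    by move: AQ; rewrite mem_compression; case: ifP => // _ /andP[->].
  by case/orP=> H; rewrite (mem_shadow H) ?orbT.
have [AQ' sAQ] : A \in Q /\ swap A \in Q.
  move: AQ mB; rewrite mem_compression /movable !inE.
  case: ifP => [_ /andP[] //|mA H /andP[/andP[_ jA]]].
  move: mA; rewrite jA /= => /negbFE iA _.
  have E : swap A = A by rewrite swap_id ?iA ?jA.
  by move: H; rewrite E orbb.
by rewrite !mem_shadow.
Qed.

Lemma deficient_compression Q : deficient Q -> deficient (compression Q).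
Proof.
rewrite /deficient card_compression; apply: leq_ltn_trans.
by rewrite -(card_compression (shadow Q)) subset_leq_card ?shadow_compression.
Qed.

(** Suppose [A] and [B] are disjoint. If one is movable, it and its swap are both original members,
    and one of them is disjoint from an original of the other. If neither is movable, one of them
    avoids [i], hence also [j], and is fixed by [swap]. *)
Lemma cross_intersecting_compression P Q :
  cross_intersecting P Q ->
  cross_intersecting (compression P) (compression Q).
Proof.
move=> PQ A B AP BQ; apply/negP=> /eqP AB0.
have disj x : x \in A -> x \in B -> False.
  by move=> xA xB; have := in_set0 x; rewrite -AB0 inE xA xB.
have AB : A \in P -> B \in Q -> False.
  by move=> A1 B1; have := PQ _ _ A1 B1; rewrite AB0 eqxx.
have sAB : swap A \in P -> swap B \in Q -> False.
  move=> A1 B1; have /set0Pn[x] := PQ _ _ A1 B1.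
  by rewrite inE !mem_swap => /andP[]; apply: disj.
have swapE C : ~~ movable C -> i \notin C -> swap C = C.
  rewrite /movable => + /negPf iC; rewrite iC andbT => /negPf jC.
  by apply: swap_id; rewrite iC jC.
move: AP BQ; rewrite !mem_compression.
case: ifP => mA; case: ifP => mB.
- by case/andP=> A1 _ /andP[B1 _]; exact: AB.
- by case/andP=> A1 A2 /orP[]; [apply: AB | apply: sAB].
- by move=> + /andP[B1 B2] => /orP[] A1; [apply: AB | apply: sAB].
have [iA|iA] := boolP (i \in A); have [iB|iB] := boolP (i \in B).
- by case: (disj i).
- rewrite (swapE B) ?mB // orbb in sAB * => + B1.
  by case/orP=> A1; [apply: AB | apply: sAB].
- rewrite (swapE A) ?mA // orbb in sAB * => A1.
  by case/orP=> B1; [apply: AB | apply: sAB].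
rewrite (swapE A) ?mA // (swapE B) ?mB // !orbb; exact: AB.
Qed.

End Compression.

(** * Ballot sets and cross-intersecting deficient families *)

Section Ballot.

Variable n : nat.
Implicit Types (A B : {set 'I_n}) (Q : {set {set 'I_n}}) (x y : 'I_n).

Definition below A (m : nat) : nat := \sum_(a in A) (a < m).

(** Members of [A] are up steps and non-members down steps of a lattice path, which must never rise
    above its start. *)
Definition ballot A := [forall m : 'I_n.+1, (below A m).*2 <= m].

Lemma below0 A : below A 0 = 0.
Proof. by rewrite /below big1. Qed.

Lemma belowS A x : below A x.+1 = below A x + (x \in A).
Proof.
rewrite /below (eq_bigr (fun a : 'I_n => (a < x) + (a == x))); last first.
  by move=> a _; rewrite -val_eqE /=; lia.
rewrite big_split /=; congr (_ + _).
have [xA|xA] := boolP (x \in A).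
  rewrite (bigD1 x) //= eqxx big1 // => a /andP[_ /negPf->] //.
by rewrite big1 // => a aA; case: eqP => // E; rewrite -E aA in xA.
Qed.

Lemma belowD1 A x m : x \in A -> below A m = below (A :\ x) m + (x < m).
Proof. by move=> xA; rewrite /below (big_setD1 x) //= addnC. Qed.

(* With [h m = 2 * below A m - m], the prefix of length [x.+1] is the first
   one maximising [h]. *)
Definition peak A x :=
  [&& x \in A,
   [forall m : 'I_n.+1, (below A m).*2 + x.+1 <= (below A x.+1).*2 + m] &
   [forall m : 'I_n.+1,
     (m <= x) ==> ((below A m).*2 + x.+1 < (below A x.+1).*2 + m)]].

Lemma exists_peak A : ~~ ballot A -> exists x, peak A x.
Proof.
rewrite negb_forall => /existsP[m0]; rewrite -ltnNge => Hm0.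
pose top (m : nat) := (m <= n) &&
  [forall l : 'I_n.+1, (below A l).*2 + m <= (below A m).*2 + l].
have ex_top : exists m, top m.
  (* [v] is the height [h] raised by [n], which keeps it nonnegative. *)
  pose v (m : 'I_n.+1) := (below A m).*2 + (n - m).
  have [m _ Hm] := @arg_maxnP 'I_n.+1 m0 predT v isT.
  exists m; rewrite /top -ltnS ltn_ord; apply/forallP=> l.
  by have := Hm l isT; have := ltn_ord l; have := ltn_ord m; rewrite /v; lia.
case: (ex_minnP ex_top) => -[|p] /andP[lepn /forallP Hp] minp.
  by have := Hp m0; rewrite below0; lia.
pose x := Ordinal lepn; exists x.
have strict (m : 'I_n.+1) : m <= x ->
    (below A m).*2 + p.+1 < (below A p.+1).*2 + m.
  move=> lemx; rewrite ltnNge; apply/negP=> ge.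
  suff /minp : top m by rewrite /= in lemx; lia.
  rewrite /top -ltnS ltn_ord; apply/forallP=> l; have := Hp l; lia.
apply/and3P; split.
(* The path is strictly lower just before its first maximum, so its step at [x] goes up. *)
- have xn : x < n.+1 by apply: ltnW.
  have := strict (Ordinal xn) (leqnn _); rewrite /=.
  by have := belowS A x; case: (x \in A) => //=; lia.
- exact/forallP.
- by apply/forallP=> m; apply/implyP; apply: strict.
Qed.

(** Let [x < y] and let [h] be the height for the common set, whose path steps down at [x] and at
    [y]. Maximality for [A] gives [h y <= h x.+1 = h x - 1]; strictness for [B] gives
    [h x < h y.+1 + 2 = h y + 1], a contradiction. *)
Lemma peak_inj A B x y :
  peak A x -> peak B y -> A :\ x = B :\ y -> x = y.
Proof.
suff nlt C D u v : peak C u -> peak D v -> C :\ u = D :\ v -> u < v -> False.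
  move=> pA pB E; apply/val_inj; have [/nlt|/nlt|//] := ltngtP x y.
    by move/(_ _ _ pA pB E).
  by move/(_ _ _ pB pA (esym E)).
move: C D u v => {}A {}B {}x {}y pA pB E ltxy.
case/and3P: pA => xA /forallP pA _; case/and3P: pB => yB _ /forallP pB.
have := pA (inord y); have /implyP := pB (inord x).
have ltn (z : 'I_n) : z < n.+1 by rewrite ltnS ltnW.
rewrite !inordK ?ltn // => /(_ (ltnW ltxy)).
rewrite !(belowD1 _ xA) !(belowD1 _ yB) E.
have := belowS (B :\ y) x; have := belowS (B :\ y) y.
rewrite setD11 -{5}E setD11; lia.
Qed.

Lemma deficient_ballot Q : deficient Q -> exists2 A, A \in Q & ballot A.
Proof.
move=> dQ; apply/exists_inP; apply: contraLR dQ; rewrite negb_exists_in.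
move=> /forall_inP noB; rewrite /deficient -leqNgt.
(* The default [A] is never reached on [Q], whose members all have a peak. *)
pose f A := if [pick x | peak A x] is Some x then A :\ x else A.
have fP A : A \in Q -> exists2 x, peak A x & f A = A :\ x.
  move=> AQ; rewrite /f; case: pickP => [x px|no]; first by exists x.
  by have [x] := exists_peak (noB A AQ); rewrite no.
have f_inj : {in Q &, injective f}.
  move=> A B /fP[x px ->] /fP[y py ->] E.
  have xy := peak_inj px py E; subst y.
  by case/and3P: px py => xA _ _ /and3P[xB _ _]; rewrite -(setD1K xA) E setD1K.
rewrite -(card_in_imset f_inj) subset_leq_card //.
apply/subsetP=> _ /imsetP[A AQ ->]; have [x /and3P[xA _ _] ->] := fP A AQ.
exact: mem_shadow.
Qed.

(** Termination measure for compressing towards smaller indices. *)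
Definition weight A : nat := \sum_(a in A) a.

Definition shifted Q := forall A x y,
  A \in Q -> x \in A -> y \notin A -> y < x -> swap y x A \in Q.

Lemma below_swap A x y m : x < m -> y < m -> below (swap y x A) m = below A m.
Proof.
move=> xm ym; rewrite /below big_imset /=; last by move=> ? ? _ _; apply: perm_inj.
by apply: eq_bigr => a _; case: tpermP => [->|->|_ _] //; rewrite xm ym.
Qed.

Lemma weight_swap A x y : y < x -> movable y x A -> weight (swap y x A) < weight A.
Proof.
move=> ltyx /andP[xA yA]; rewrite /weight big_imset /=; last first.
  by move=> ? ? _ _; apply: perm_inj.
rewrite (bigD1 x) //= (bigD1 x (P := mem A)) //= tpermR -addSn leq_add //.
apply: leq_sum => a /andP[aA ax]; rewrite tpermD // eq_sym //.
by apply: contraNneq yA => <-.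
Qed.

(* If [x] is the least common element, fewer than [x] elements of [A] and [B]
   lie below [x], so [x] can be moved in [A] to a place free in both. *)
Lemma shifted_ballot_disjoint P A B :
  shifted P -> A \in P -> ballot A -> ballot B ->
  exists2 C, C \in P & C :&: B = set0.
Proof.
move=> sP AP bA bB.
(* Moving an element down can destroy [ballot A], so the induction carries only this bound at common
   elements. It survives because those remaining lie above both swapped points. *)
have : forall x, x \in A :&: B -> below A x.+1 + below B x.+1 <= x.+1.
  move=> x _; move/forallP: bA => /(_ (inord x.+1)).
  move/forallP: bB => /(_ (inord x.+1)).
  by rewrite inordK ?ltnS //; lia.
have [s] := ubnP #|A :&: B|; elim: s A AP {bA} => // s IH A AP leS bAB.
have [AB0|[x0 x0AB]] := set_0Vmem (A :&: B); first by exists A.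
have [x xAB xmin] := @arg_minnP _ x0 (mem (A :&: B)) val x0AB.
have /andP[xA xB] : (x \in A) && (x \in B) by rewrite -in_setI.
have [y /and3P[ltyx yA yB]] : exists y : 'I_n, [&& y < x, y \notin A & y \notin B].
  apply/existsP; apply: contraT; rewrite negb_exists => /forallP no.
  have : x <= below A x + below B x.
    have {1}-> : (x : nat) = \sum_(a : 'I_n) (a < x).
      rewrite -[in LHS](@card_ord x) -sum1_card.
      rewrite (big_ord_widen_cond n xpredT (fun=> 1)) 1?ltnW //=.
      by rewrite -big_mkcond.
    rewrite /below (big_mkcond (mem A)) (big_mkcond (mem B)) -big_split /=.
    apply: leq_sum => a _; have := no a.
    by case: (a < x); case: (a \in A); case: (a \in B).
  by have := bAB _ xAB; rewrite !belowS xA xB; lia.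
have sub : swap y x A :&: B \subset (A :&: B) :\ x.
  apply/subsetP=> z; rewrite !inE mem_swap.
  case: tpermP => [->|->|zy zx]; rewrite ?(negPf yB) ?(negPf yA) ?andbF //.
  by move=> ->; case: eqP zx.
apply: (IH (swap y x A)); first exact: sP.
  apply: (leq_ltn_trans (subset_leq_card sub)).
  by rewrite (cardsD1 x) inE xA xB in leS.
move=> z /(subsetP sub); rewrite in_setD1 => /andP[zx zAB].
have lexz := xmin z zAB.
have ltxz : x < z by rewrite ltn_neqAle [_ <= _]lexz andbT eq_sym.
by rewrite below_swap ?bAB //; lia.
Qed.

(** Induction on the total weight of [P]. Both families undergo the same compressions, which stop
    once [P] is shifted; [Q] then supplies just a ballot set. *)
Lemma cross_intersecting_not_deficient P Q :
  cross_intersecting P Q -> deficient P -> ~~ deficient Q.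
Proof.
move=> PQ dP; apply/negP=> dQ.
have [s] := ubnP (\sum_(A in P) weight A).
elim: s P Q PQ dP dQ => // s IH P Q PQ dP dQ leS.
have [/existsP[A /existsP[x /existsP[y /and5P[AP xA yA ltyx sA]]]]|no] :=
  boolP [exists A : {set 'I_n}, exists x : 'I_n, exists y : 'I_n,
    [&& A \in P, x \in A, y \notin A, y < x & swap y x A \notin P]].
- apply: (IH (compression y x P) (compression y x Q));
    [exact: cross_intersecting_compression | exact: deficient_compression
    | exact: deficient_compression |].
  rewrite ltnS in leS; apply: leq_trans leS; rewrite /compression.
  rewrite big_imset /=; last first.
    (* Injectivity of [compress] on [P] is read off from the equality of cardinalities. *)
    by apply/imset_injP; rewrite -/(compression y x P) card_compression.
  rewrite (bigD1 A) //= (bigD1 A (P := mem P)) //= -addSn leq_add //.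
    by rewrite /compress /movable xA yA sA weight_swap //= /movable xA.
  apply: leq_sum => B _; rewrite /compress; case: ifP => // /andP[mB _].
  by apply/ltnW/weight_swap.
have sP : shifted P.
  move=> A x y AP xA yA ltyx; apply: contraNT no => sA.
  apply/existsP; exists A; apply/existsP; exists x; apply/existsP; exists y.
  exact/and5P.
have [A AP bA] := deficient_ballot dP; have [B BQ bB] := deficient_ballot dQ.
have [C CP CB] := shifted_ballot_disjoint sP AP bA bB.
by have := PQ C B CP BQ; rewrite CB eqxx.
Qed.

End Ballot.

(** * Traces of a family on a vertex set *)

Section Traces.

Variable T : finType.
Implicit Types (U C A B : {set T}) (Z F : {set {set T}}).

Definition fibre Z U (m : nat) C : {set {set T}} :=
  [set A :&: U | A in [set A in Z | (#|A :&: U| == m) && (A :\: U == C)]].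

Lemma mem_fibre Z U m C B : B \in fibre Z U m C ->
  [/\ B :|: C \in Z, #|B| = m, B \subset U & [disjoint C & U]].
Proof.
case/imsetP=> A; rewrite inE => /and3P[AZ /eqP cA /eqP <-] ->.
split; rewrite ?setID ?subsetIr // -setI_eq0; apply/eqP/setP=> z.
by rewrite !inE; case: (z \in U); rewrite ?andbF.
Qed.

(* Shadows of a fibre have trace smaller than [m], shadows of sets with trace
   larger than [m] do not, so the two contributions to [shadow Z] add up. *)
Lemma deficient_trace Z U m :
  (forall A, A \in Z -> m <= #|A :&: U|) -> deficient Z ->
  deficient [set A in Z | m < #|A :&: U|] \/
  exists C, deficient (fibre Z U m C).
Proof.
move=> geZ dZ; set Z1 := [set A in Z | _].
have [|dZ1] := boolP (deficient Z1); [by left | right].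
apply/existsP; apply: contraLR dZ; rewrite negb_exists => /forallP dC.
rewrite /deficient -!leqNgt in dZ1; rewrite /deficient -leqNgt.
pose Z0 := [set A in Z | #|A :&: U| == m].
have -> : #|Z| = #|Z0| + #|Z1|.
  rewrite -(cardsID [set A : {set T} | #|A :&: U| == m] Z); congr (_ + _).
    by apply: eq_card => A; rewrite !inE.
  apply: eq_card => A; rewrite !inE andbC; case AZ: (A \in Z) => //=.
  by rewrite ltn_neqAle geZ // andbT eq_sym.
rewrite -(cardsID [set B : {set T} | #|B :&: U| < m] (shadow Z)).
apply: leq_add; last first.
  apply: (leq_trans dZ1); apply: subset_leq_card; apply/subsetP=> B.
  move=> BZ1; rewrite !inE.
  have sZ : Z1 \subset Z by apply/subsetP=> A; rewrite inE => /andP[].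
  rewrite (subsetP (shadowS sZ)) // andbT -leqNgt.
  case/shadowP: BZ1 => A [x [+ xA ->]]; rewrite inE => /andP[_].
  rewrite (cardsD1 x (A :&: U)) => H.
  have -> : (A :\ x) :&: U = (A :&: U) :\ x by rewrite setIDAC.
  by move: H; case: (_ \in _) => /=; lia.
have split_card (G : {set {set T}}) :
    #|G| = \sum_(C : {set T}) #|[set A in G | A :\: U == C]|.
  rewrite -sum1_card (partition_big (fun A => A :\: U) xpredT) //=.
  by apply: eq_bigr => C _; rewrite -sum1_card; apply: eq_bigl => A; rewrite inE.
rewrite (split_card Z0) (split_card (_ :&: _)); apply: leq_sum => C _.
have card_fibre : #|[set A in Z0 | A :\: U == C]| = #|fibre Z U m C|.
  rewrite /fibre card_in_imset.
    by apply: eq_card => A; rewrite !inE andbA.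
  move=> A B; rewrite !inE => /and3P[_ _ /eqP CA] /and3P[_ _ /eqP CB] E.
  by rewrite -(setID A U) -(setID B U) E CA CB.
rewrite card_fibre; apply: (@leq_trans #|shadow (fibre Z U m C)|).
  by have := dC C; rewrite /deficient -leqNgt.
(* Adding [C] back sends the shadow of the fibre into the shadow of [Z]; [S] and [C] are recovered
   as the parts inside and outside [U], so nothing is counted twice. *)
have key S : S \in shadow (fibre Z U m C) ->
    [/\ S :|: C \in shadow Z, (S :|: C) :&: U = S, #|S| < m & (S :|: C) :\: U = C].
  case/shadowP=> B [x [/mem_fibre[BZ cB BU dCU] xB ->]].
  have xC : x \notin C.
    by rewrite (disjointFl dCU) // (subsetP BU).
  have BxU : B :\ x \subset U by apply: subset_trans BU; rewrite subsetDl.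
  split.
  - have -> : B :\ x :|: C = (B :|: C) :\ x.
      by rewrite setDUl; congr (_ :|: _); apply/esym/setDidPl;
        rewrite disjoint_sym disjoints1.
    by apply: mem_shadow; rewrite // inE xB.
  - by rewrite setIUl (setIidPl BxU) (disjoint_setI0 dCU) setU0.
  - by rewrite -cB (cardsD1 x B) xB.
  - rewrite setDUl (setDidPl dCU); move: BxU; rewrite -setD_eq0 => /eqP->.
    by rewrite set0U.
rewrite -(@card_in_imset _ _ (fun S => S :|: C) (mem (shadow (fibre Z U m C)))); last first.
  by move=> S S' /key[_ E _ _] /key[_ E' _ _] H; rewrite -E -E' H.
apply: subset_leq_card; apply/subsetP=> _ /imsetP[S /key[SZ E lt CE] ->].
by rewrite !inE SZ E lt CE eqxx.
Qed.

End Traces.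

(** * Growing the set [U], and the final count *)

Lemma mem_link (T : finType) (F : {set {set T}}) (i : T) (A : {set T}) :
  A \in link F i -> i \notin A /\ i |: A \in F.
Proof.
case/imsetP=> B; rewrite inE => /andP[BF iB] ->.
by rewrite setD11 setD1K.
Qed.

Lemma exists_trace_set (n k m : nat) (F : {set {set 'I_n}}) :
  uniform k F -> intersecting F ->
  (forall i, deficient (link F i)) -> m <= k ->
  exists2 U : {set 'I_n}, #|U| <= \sum_(l < m) (k - l) &
    forall i, i \notin U -> exists Z : {set {set 'I_n}},
      [/\ Z \subset link F i, deficient Z & forall A, A \in Z -> m <= #|A :&: U|].
Proof.
move=> uF iF dF; elim: m => [_|m IH ltmk].
  exists set0; first by rewrite cards0.
  by move=> i _; exists (link F i); split.
have [U cU HU] := IH (ltnW ltmk).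
pose raised i := [exists Z : {set {set 'I_n}}, [&& Z \subset link F i, deficient Z &
  [forall A in Z, m < #|A :&: U|]]].
have [/forall_inP all_raised|] := boolP [forall (i | i \notin U), raised i].
  exists U => [|i /all_raised /existsP[Z /and3P[sZ dZ /forall_inP gZ]]].
    by rewrite big_ord_recr /=; apply: leq_trans cU (leq_addr _ _).
  by exists Z; split.
rewrite negb_forall_in => /exists_inP[i iU not_raised].
have [Z [sZ dZ gZ]] := HU i iU.
have [dZ1|[C dC]] := deficient_trace gZ dZ.
  case/negP: not_raised; apply/existsP; exists [set A in Z | m < #|A :&: U|].
  apply/and3P; split=> //.
    by apply: subset_trans sZ; apply/subsetP=> A; rewrite inE => /andP[].
  by apply/forall_inP => A; rewrite inE => /andP[].
have /card_gt0P[S0 S0C] : 0 < #|fibre Z U m C| by apply: leq_ltn_trans dC.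
have [S0Z cS0 S0U dCU] := mem_fibre S0C.
have [iS0 iS0F] := mem_link (subsetP sZ _ S0Z).
(* The [k]-set [i |: (S0 :|: C)] has [m] points in [S0]; the rest, [i] and [C], are what [U] gains,
   matching the new summand. *)
have cC : #|C|.+1 = k - m.
  have := uF _ iS0F; rewrite cardsU1 iS0 cardsU disjoint_setI0; last first.
    by rewrite disjoint_sym; apply: disjointWr S0U _.
  by rewrite cards0; lia.
exists (U :|: (i |: C)) => [|j].
  rewrite big_ord_recr /= (leq_trans (leq_card_setU _ _)) // leq_add //.
  by rewrite cardsU1 -cC; case: (_ \notin _).
rewrite !inE !negb_or => /and3P[jU ji jC].
have [Y [sY dY gY]] := HU j jU.
have gY' A : A \in Y -> m <= #|A :&: (U :|: (i |: C))|.
  by move/gY => H; apply: (leq_trans H); apply/subset_leq_card/setIS/subsetUl.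
have [dY1|[D dD]] := deficient_trace gY' dY.
  exists [set A in Y | m < #|A :&: (U :|: (i |: C))|]; split=> //.
    by apply: subset_trans sY; apply/subsetP=> A; rewrite inE => /andP[].
  by move=> A; rewrite inE => /andP[].
suff cross : cross_intersecting (fibre Z U m C) (fibre Y (U :|: (i |: C)) m D).
  by have := cross_intersecting_not_deficient cross dC; rewrite dD.
move=> A B /mem_fibre[AZ cA AU _] /mem_fibre[BY cB BU dDU].
have dDU0 : D :&: U = set0.
  by apply/disjoint_setI0; apply: disjointWr dDU; rewrite subsetUl.
(* [B :|: D] meets the old [U] in at least [m] points, none of them in [D], while [B] has only
   [m]. *)
have BU' : B \subset U.
  have := gY _ BY; rewrite setIUl dDU0 setU0 => H.
  by apply/setIidPl/eqP; rewrite eqEcard subsetIl cB.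
have [_ iF1] := mem_link (subsetP sZ _ AZ).
have [_ jF1] := mem_link (subsetP sY _ BY).
(* The common point [x] lies in the enlarged set, which misses [j] and [D], so it is in [B] and
   hence in [U]; as [U] misses [i] and [C], it is also in [A]. *)
have /set0Pn[x] := iF _ _ iF1 jF1; rewrite !inE => /andP[H1 H2].
apply/set0Pn; exists x; rewrite inE.
have xW : x \in U :|: (i |: C).
  rewrite !inE; case/or3P: H1 => [->|xA|->]; rewrite ?orbT //.
  by rewrite (subsetP AU).
have xB : x \in B.
  case/or3P: H2 => [/eqP xj|//|xD].
    by move: xW; rewrite xj !inE (negPf jU) (negPf ji) (negPf jC).
  by move: xW; rewrite (disjointFr dDU xD).
have xU := subsetP BU' _ xB.
rewrite xB andbT; case/or3P: H1 => [/eqP xi|//|xC].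
  by rewrite -xi xU in iU.
by rewrite (disjointFr dCU xC) in xU.
Qed.

Theorem theorem1p3 (n k : nat) (n_gt0 : 0 < n) (k_gt0 : 0 < k)
    (n_large : 'C(k.+1, 2) < n) (F : {set {set 'I_n}})
    (F_uniform : uniform k F) (F_intersecting : intersecting F) :
  exists i : 'I_n, #|link F i| <= #|shadow (link F i)|.
Proof.
apply/existsP; apply: contraT; rewrite negb_exists => /forallP dF.
have dF' i : deficient (link F i) by rewrite /deficient ltnNge.
have [U cU HU] := exists_trace_set F_uniform F_intersecting dF' (leqnn k).
have sumE : \sum_(l < k) (k - l) = 'C(k.+1, 2).
  rewrite -bin2_sum big_mkord big_ord_recl add0n.
  rewrite (reindex_inj rev_ord_inj) /=; apply: eq_bigr => l _.
  by have := ltn_ord l; rewrite /bump; lia.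
have /set0Pn[i] : ~: U != set0.
  by rewrite -card_gt0; have := cardsC U; rewrite card_ord; lia.
rewrite inE => /HU[Z [sZ dZ gZ]].
(* A member of [Z] has [k - 1] elements, yet would meet [U] in at least [k]. *)
have /card_gt0P[A AZ] : 0 < #|Z| by apply: leq_ltn_trans dZ.
have [iA iAF] := mem_link (subsetP sZ _ AZ).
have := F_uniform _ iAF; rewrite cardsU1 iA.
by have := gZ A AZ; have := subset_leq_card (subsetIl A U); lia.
Qed.
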